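(* Let $G$ be a group of odd order and let $X$ be a non-empty integral, normal Cayley graph for $G$. Then $X$ has an odd eigenvalue.
   Context: Let $G$ be a finite group with identity $e$, and let $\mathcal{C}\subseteq G\setminus\{e\}$ satisfy $\mathcal{C}^{-1}=\mathcal{C}$. The Cayley graph $\mathrm{Cay}(G,\mathcal{C})$ is the (undirected) graph with vertex set $G$ and arc set $\{(g,h): hg^{-1}\in\mathcal{C}\}$; $\mathcal{C}$ is its connection set. It is non-empty if it has at least one edge, i.e. $\mathcal{C}\neq\emptyset$. It is normal if $\mathcal{C}$ is a union of conjugacy classes of $G$. The adjacency matrix of the graph is the matrix $A$ indexed by $G$ with $A_{gh}=1$ if $hg^{-1}\in\mathcal{C}$ and $A_{gh}=0$ otherwise. The eigenvalues of the graph are the eigenvalues of $A$, and the graph is integral if all its eigenvalues are integers. *)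

(* Defs.v *)
From mathcomp Require Import all_boot all_order all_fingroup all_algebra.

Set Implicit Arguments.
Unset Strict Implicit.
Unset Printing Implicit Defensive.

Import GroupScope GRing.Theory.
Local Open Scope ring_scope.

Definition connection_set (gT : finGroupType) (G : {group gT})
    (C : {set gT}) : Prop :=
  C \subset G^#%g /\ (C^-1)%g = C.

(* The arc relation of Cay(G, C), meant to be used on the vertex set G. *)
Definition cayley (gT : finGroupType) (C : {set gT}) : rel gT :=
  fun g h => (h * g^-1)%g \in C.

Definition cayley_nonempty (gT : finGroupType) (G : {group gT})
    (C : {set gT}) : Prop :=
  exists g h, [/\ g \in G, h \in G & cayley C g h].

Definition cayley_normal (gT : finGroupType) (G : {group gT})
    (C : {set gT}) : Prop :=
  exists2 P : {set {set gT}}, P \subset classes G & C = cover P.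

(* Rows and columns are indexed by G through its enumeration
   enum_val : 'I_#|G| -> gT. *)
Definition cayley_adjmx (F : nzRingType) (gT : finGroupType) (G : {group gT})
    (C : {set gT}) : 'M[F]_#|G| :=
  \matrix_(i, j) (cayley C (enum_val i) (enum_val j))%:R.

Definition cayley_eigenvalue (F : fieldType) (gT : finGroupType)
    (G : {group gT}) (C : {set gT}) (a : F) : bool :=
  eigenvalue (cayley_adjmx F G C) a.

(* F plays the role of the complex numbers; being algebraically closed, it
   contains every eigenvalue of the 0-1 adjacency matrix. *)
Definition cayley_integral (F : numClosedFieldType) (gT : finGroupType)
    (G : {group gT}) (C : {set gT}) : Prop :=
  forall a : F, cayley_eigenvalue G C a -> exists m : int, a = m%:~R.

(* Main.v *)
Require Import Defs.
From mathcomp Require Import all_boot all_order all_fingroup all_algebra.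

Set Implicit Arguments.
Unset Strict Implicit.
Unset Printing Implicit Defensive.

Import GroupScope GRing.Theory.
Local Open Scope ring_scope.

(** Suppose that every eigenvalue is even. The characteristic polynomial of the
    integer adjacency matrix A is then a product of factors X - m with m even,
    so modulo 2 it is X^n, with n = |G|, and by Cayley-Hamilton the reduction
    of A to F_2 is nilpotent.

    On the other hand, A is the sum of the left translations by the elements
    of C. As C is a union of conjugacy classes, this sum is central in the
    group algebra, so A commutes with the matrix L of the left translation by
    any h in G ([cayley_adjmx_trans_comm]). Hence A L is also nilpotent modulo
    2, and so has trace 0 in F_2 ([mxtrace_nilpotent_pchar2]). But a
    nontrivial translation has no fixed point, so that the trace of A L only
    sees the coefficient of h^-1 in A: it is |G| or 0 according to whether h^-1
    lies in C ([mxtrace_cayley_adjmx_trans]). With |G| odd, this rules out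
    every possible element of C.

    In other words, the group algebra of G over F_2 is semisimple because |G|
    is odd, so its centre contains no nonzero nilpotent element. *)

(** Off the diagonal, the terms B i j * B j i of the trace of B^2 come in equal
    pairs, which cancel in characteristic 2; the diagonal leaves the sum of the
    squares, which is the square of the sum. *)
Lemma mxtrace_sqr_pchar2 (R : comNzRingType) (n : nat) (B : 'M[R]_n) :
  2%N \in [pchar R] -> \tr (B ^+ 2) = \tr B ^+ 2.
Proof.
move=> char2; rewrite -(pFrobenius_autE char2) /mxtrace raddf_sum /=.
pose t i j := B i j * B j i.
have diag i : (B ^+ 2) i i = t i i + \sum_(j < n | j != i) t i j.
  by rewrite expr2 mxE (bigD1 i).
rewrite (eq_bigr _ (fun i _ => diag i)) big_split /=.
have split_off i : \sum_(j < n | j != i) t i j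
    = \sum_(j < n | (j < i)%N) t i j + \sum_(j < n | (i < j)%N) t i j.
  rewrite (bigID (fun j : 'I_n => (j < i)%N)) /=.
  by congr (_ + _); apply: eq_bigl => j; rewrite -val_eqE /=; case: ltngtP.
rewrite [X in _ + X](eq_bigr _ (fun i _ => split_off i)) big_split /=.
have -> : \sum_(i < n) \sum_(j < n | (i < j)%N) t i j
    = \sum_(i < n) \sum_(j < n | (j < i)%N) t i j.
  rewrite (exchange_big_dep predT) //=.
  by apply: eq_bigr => i _; apply: eq_bigr => j _; rewrite /t mulrC.
rewrite (addrr_pchar2 char2) addr0.
by apply: eq_bigr => i _; rewrite pFrobenius_autE expr2.
Qed.

(** Iterating [mxtrace_sqr_pchar2], the trace of B^(2^m) is the 2^m-th power of
    the trace of B; it vanishes as soon as 2^m >= k. *)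
Lemma mxtrace_nilpotent_pchar2 (R : idomainType) (n k : nat) (B : 'M[R]_n) :
  2%N \in [pchar R] -> B ^+ k = 0 -> \tr B = 0.
Proof.
move=> char2 Bk0.
have tr_pow m : \tr (B ^+ (2 ^ m)) = \tr B ^+ (2 ^ m).
  elim: m => [|m IHm]; first by rewrite expn0 !expr1.
  by rewrite expnSr !exprM mxtrace_sqr_pchar2 // IHm.
have /eqP := tr_pow k.
rewrite -(subnK (ltnW (ltn_expl k (ltnSn 1)))) exprD Bk0 mulr0 mxtrace0.
by rewrite eq_sym expf_eq0 => /andP[_ /eqP].
Qed.

Lemma char_poly_Xn_nilpotent (R : comNzRingType) (n : nat) (B : 'M[R]_n) :
  char_poly B = 'X^n -> B ^+ n = 0.
Proof.
case: n B => [|n] B charB; first exact: flatmx0.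
by have := Cayley_Hamilton B; rewrite charB rmorphXn /= horner_mx_X.
Qed.

(** The factorization over F descends to the integers because the embedding
    of the integers into F is injective. It must live over the integers to be
    reduced modulo 2. *)
Lemma char_poly_int_roots (F : numClosedFieldType) (n : nat) (A : 'M[int]_n) :
  (forall a : F, eigenvalue (map_mx intr A) a -> exists m : int, a = m%:~R) ->
  exists2 ms : seq int, char_poly A = \prod_(m <- ms) ('X - m%:P)
    & forall m, m \in ms -> eigenvalue (map_mx intr A) (m%:~R : F).
Proof.
move=> intA; set AF := map_mx intr A in intA *.
have [rs] := closed_field_poly_normal (char_poly AF).
rewrite (monicP (char_poly_monic _)) scale1r => def_charAF.
have rs_eig a : a \in rs -> eigenvalue AF a.
  by rewrite eigenvalue_root_char def_charAF root_prod_XsubC.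
have [ms def_rs] : exists ms : seq int, rs = [seq m%:~R | m <- ms].
  elim: rs rs_eig {def_charAF} => [|a rs IHrs] rs_eig; first by exists [::].
  have [b b_rs|ms ->] := IHrs; first by apply: rs_eig; rewrite inE b_rs orbT.
  have [m ->] := intA a (rs_eig a (mem_head _ _)).
  by exists (m :: ms).
exists ms => [|m m_ms]; last by apply: rs_eig; rewrite def_rs map_f.
apply: (@map_inj_poly _ _ (intr : int -> F)) => //; first exact: intr_inj.
rewrite map_char_poly def_charAF def_rs big_map rmorph_prod /=.
by apply: eq_bigr => m _; rewrite rmorphB /= map_polyX map_polyC.
Qed.

Lemma even_intr_pchar2 (R : nzRingType) (m : int) :
  2%N \in [pchar R] -> ~~ odd `|m|%N -> m%:~R = 0 :> R.
Proof.
move=> char2; rewrite -dvdn2 (dvdn_pcharf char2).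
by case: m => n => [|/eqP n0]; [move/eqP | rewrite NegzE mulrNz [_%:~R]n0 oppr0].
Qed.

(** With row vectors, this is the permutation matrix of g |-> h * g. *)
Definition translation_mx (R : nzRingType) (gT : finGroupType)
    (G : {group gT}) (h : gT) : 'M[R]_#|G| :=
  \matrix_(i, j) (enum_val j == h * enum_val i)%g%:R.

Lemma cayley_adjmx_trans (R : nzRingType) (gT : finGroupType)
    (G : {group gT}) (C : {set gT}) (h : gT) : h \in G ->
  cayley_adjmx R G C *m translation_mx R G h
    = \matrix_(i, j) (h^-1 * enum_val j * (enum_val i)^-1 \in C)%g%:R.
Proof.
move=> Gh; apply/matrixP=> i j; rewrite !mxE.
have [k0 val_k0] : {k0 : 'I_#|G| | enum_val k0 = (h^-1 * enum_val j)%g}.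
  have Ghj : (h^-1 * enum_val j)%g \in G by rewrite groupM ?groupV ?enum_valP.
  by exists (enum_rank_in Ghj (h^-1 * enum_val j)%g); rewrite enum_rankK_in.
rewrite (bigD1 k0) //= !mxE /cayley val_k0 mulKVg eqxx mulr1.
rewrite big1 ?addr0 // => k ne_k; rewrite !mxE.
case: eqP => [def_j|_]; last by rewrite mulr0.
by case/eqP: ne_k; apply: enum_val_inj; rewrite val_k0 def_j mulKg.
Qed.

Lemma trans_cayley_adjmx (R : nzRingType) (gT : finGroupType)
    (G : {group gT}) (C : {set gT}) (h : gT) : h \in G ->
  translation_mx R G h *m cayley_adjmx R G C
    = \matrix_(i, j) (enum_val j * (enum_val i)^-1 * h^-1 \in C)%g%:R.
Proof.
move=> Gh; apply/matrixP=> i j; rewrite !mxE.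
have [k0 val_k0] : {k0 : 'I_#|G| | enum_val k0 = (h * enum_val i)%g}.
  have Ghi : (h * enum_val i)%g \in G by rewrite groupM ?enum_valP.
  by exists (enum_rank_in Ghi (h * enum_val i)%g); rewrite enum_rankK_in.
rewrite (bigD1 k0) //= !mxE /cayley val_k0 eqxx mul1r invMg mulgA.
rewrite big1 ?addr0 // => k ne_k; rewrite !mxE.
case: eqP => [def_k|_]; last by rewrite mul0r.
by case/eqP: ne_k; apply: enum_val_inj; rewrite val_k0.
Qed.

Lemma cayley_normal_memJ (gT : finGroupType) (G : {group gT}) (C : {set gT})
    (x y : gT) : cayley_normal G C -> y \in G -> ((x ^ y)%g \in C) = (x \in C).
Proof.
case=> P /subsetP sPG -> Gy.
have stable z u : u \in G -> z \in cover P -> (z ^ u)%g \in cover P.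
  move=> Gu /bigcupP[K PK Kz]; apply/bigcupP; exists K => //.
  have /imsetP[w Gw defK] := sPG K PK.
  by rewrite defK memJ_norm -?defK // defK (subsetP (class_norm w G)).
apply/idP/idP; last exact: stable.
by move/(stable _ _ (groupVr Gy)); rewrite conjgK.
Qed.

(** The two products differ by a conjugation by h inside the membership test
    for C, which normality makes invisible. *)
Lemma cayley_adjmx_trans_comm (R : nzRingType) (gT : finGroupType)
    (G : {group gT}) (C : {set gT}) (h : gT) :
  cayley_normal G C -> h \in G ->
  GRing.comm (cayley_adjmx R G C) (translation_mx R G h).
Proof.
move=> normalC Gh; rewrite /GRing.comm [LHS]cayley_adjmx_trans //.
rewrite [RHS]trans_cayley_adjmx //; apply/matrixP=> i j; rewrite !mxE.
rewrite -(cayley_normal_memJ (h^-1 * _ * _)%g normalC (groupVr Gh)).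
by rewrite conjgE invgK -!mulgA mulKVg.
Qed.

(** On the diagonal the two vertices cancel, so every entry is the same test. *)
Lemma mxtrace_cayley_adjmx_trans (R : nzRingType) (gT : finGroupType)
    (G : {group gT}) (C : {set gT}) (h : gT) : h \in G ->
  \tr (cayley_adjmx R G C *m translation_mx R G h) = (h^-1 \in C)%g%:R *+ #|G|.
Proof.
move=> Gh; rewrite cayley_adjmx_trans // /mxtrace.
under eq_bigr do rewrite mxE mulgK.
by rewrite sumr_const card_ord.
Qed.

Lemma map_cayley_adjmx (R S : nzRingType) (f : {rmorphism R -> S})
    (gT : finGroupType) (G : {group gT}) (C : {set gT}) :
  map_mx f (cayley_adjmx R G C) = cayley_adjmx S G C.
Proof. by apply/matrixP=> i j; rewrite !mxE rmorph_nat. Qed.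

Theorem theorem6p1 (F : numClosedFieldType) (gT : finGroupType)
    (G : {group gT}) (C : {set gT})
    (oddG : odd #|G|)
    (connC : connection_set G C)
    (nonemptyX : cayley_nonempty G C)
    (integralX : cayley_integral F G C)
    (normalX : cayley_normal G C) :
  exists m : int, cayley_eigenvalue G C (m%:~R : F) /\ odd `|m|%N.
Proof.
have pchar2 : 2%N \in [pchar 'F_2] by exact: pchar_Fp.
pose A := cayley_adjmx int G C.
have intA (a : F) : eigenvalue (map_mx intr A) a -> exists m : int, a = m%:~R.
  by rewrite map_cayley_adjmx; apply: integralX.
have [ms charA ms_eig] := char_poly_int_roots intA.
(* The parity of the finitely many roots is decidable, which yields the odd
   eigenvalue unless all the roots are even. *)
have [/hasP[m m_ms odd_m]|/hasPn even_ms] := boolP (has (fun m => odd `|m|%N) ms).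
  by exists m; split=> //; rewrite /cayley_eigenvalue -(map_cayley_adjmx intr) ms_eig.
pose A2 := cayley_adjmx 'F_2 G C.
have nilA2 : A2 ^+ #|G| = 0.
  apply: char_poly_Xn_nilpotent.
  have sz_ms : size ms = #|G|.
    by apply: succn_inj; rewrite -(size_char_poly A) charA size_prod_XsubC.
  rewrite /A2 -(map_cayley_adjmx intr) -map_char_poly charA rmorph_prod /=.
  rewrite -sz_ms -iter_mulr_1 -(count_predT ms) -big_const_seq.
  apply: eq_big_seq => m /even_ms even_m.
  rewrite rmorphB /= map_polyX map_polyC /=.
  by rewrite (even_intr_pchar2 pchar2 even_m) subr0.
(* The translation by the inverse of an element of C contradicts nilpotency. *)
have [g [h [Gg Gh Cgh]]] := nonemptyX.
have Gc : (h * g^-1)^-1%g \in G by rewrite groupV groupM ?groupV.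
have nilA2c : (A2 * translation_mx _ G (h * g^-1)^-1%g) ^+ #|G| = 0.
  by rewrite exprMn_comm ?nilA2 ?mul0r //; apply: cayley_adjmx_trans_comm.
have /eqP := mxtrace_nilpotent_pchar2 pchar2 nilA2c.
rewrite mxtrace_cayley_adjmx_trans // invgK.
move: Cgh; rewrite /cayley => ->.
by rewrite -(dvdn_pcharf pchar2) dvdn2 oddG.
Qed.
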